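(* Let $D_1\subseteq D_2\subseteq\cdots$ be an ascending sequence of Noetherian GCD domains and let $D=\bigcup_{n=1}^{\infty}D_n$ be their directed union. Then the following conditions are equivalent: (1) $D$ is a Strong Bezout Intersection domain (SBID). (2) $D$ is local and its maximal ideal $\mathfrak{m}$ is a directed union of principal ideals of $D$.
   Context: An integral domain $D$ is a GCD domain if for all $a,b\in D$ the ideal $aD\cap bD$ is principal. An integral domain $D$ is a Strong Bezout Intersection domain (SBID) if, for $a_1,\ldots,a_s\in D$ ($s\ge 1$), whenever the ideal $I=a_1D\cap\cdots\cap a_sD$ is finitely generated, then $I=a_iD$ for some $i\in\{1,\ldots,s\}$. A local ring is a ring with a unique maximal ideal; it need not be Noetherian. An ideal is a directed union of principal ideals if it is the union of a family of principal ideals such that any two members of the family are both contained in a third member. *)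

(* Defs.v *)
From HB Require Import structures.
From mathcomp Require Import all_boot all_order all_algebra.
From mathcomp Require Import classical_sets.

Set Implicit Arguments.
Unset Strict Implicit.
Unset Printing Implicit Defensive.

Import GRing.Theory.

Local Open Scope ring_scope.
Local Open Scope classical_set_scope.

Section Subring.
Variables (R : comNzRingType) (S : subringClosed R).

Record subring := Subring { subring_val : R; subring_valP : subring_val \in S }.

HB.instance Definition _ := [isSub for subring_val].
HB.instance Definition _ := [Choice of subring by <:].
HB.instance Definition _ := [SubChoice_isSubComNzRing of subring by <:].

End Subring.

(* Properties of rings are stated over comNzRingType, with integrality as a
   Prop: a subring of an idomainType carries no canonical inverse operation,
   hence is not itself an idomainType. *)
Section Rings.
Variable R : comNzRingType.
Implicit Types (a b : R) (I J : set R).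

Definition ideal I :=
  I 0 /\ forall a x y, I x -> I y -> I (a * x + y).

Definition span (n : nat) (g : 'I_n -> R) : set R :=
  [set x | exists c : 'I_n -> R, x = \sum_(i < n) c i * g i].

Definition fin_gen I := exists (n : nat) (g : 'I_n -> R), I = span g.

Definition principal a : set R := [set x | exists c, x = a * c].

Definition domain := GRing.integral_domain_axiom R.

Definition noetherian := forall I, ideal I -> fin_gen I.

Definition gcd_domain :=
  domain /\ forall a b, exists c, principal a `&` principal b = principal c.

Definition sbid :=
  domain /\
  forall (s : nat) (a : 'I_s -> R), (0 < s)%N ->
    fin_gen (\bigcap_(i in [set: 'I_s]) principal (a i)) ->
    exists i, \bigcap_(j in [set: 'I_s]) principal (a j) = principal (a i).

Definition maximal_ideal I :=
  [/\ ideal I, ~ I 1 & forall J, ideal J -> ~ J 1 -> I `<=` J -> J = I].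

Definition local_ring := exists! m, maximal_ideal m.

Definition directed_union_of_principal I :=
  exists F : set (set R),
    [/\ forall J, F J -> exists a, J = principal a,
        forall J K, F J -> F K -> exists2 L, F L & J `<=` L /\ K `<=` L
      & I = \bigcup_(J in F) J].

End Rings.

Arguments domain : clear implicits.
Arguments noetherian : clear implicits.
Arguments gcd_domain : clear implicits.
Arguments sbid : clear implicits.
Arguments local_ring : clear implicits.

(* Main.v *)
Require Import Defs.
From HB Require Import structures.
From mathcomp Require Import all_boot all_order all_algebra.
From mathcomp Require Import boolp classical_sets.
From mathcomp Require Import ring.

(** A finitely generated intersection of principal ideals of [D] is the union
    of the corresponding intersections in the GCD domains [D_n], which are
    principal, hence it is itself principal, say generated by [l = a_i b_i].
    If [D] is local and its maximal ideal is a directed union of principal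
    ideals, and no [b_i] is a unit, then the [b_i] have a common non-unit
    divisor [c]; then [l / c] is in the intersection, so [c] is a unit.
    Conversely, let [a] and [b] be nonzero non-units of an SBID.  If their gcd
    in each [D_n] is a unit of [D], then [aD `&` bD = abD], so [a] or [b] is a
    unit; hence some gcd is a common non-unit divisor of [a] and [b]. *)

Set Implicit Arguments.
Unset Strict Implicit.
Unset Printing Implicit Defensive.

Import GRing.Theory.

Local Open Scope ring_scope.
Local Open Scope classical_set_scope.

(** * Finitely many conditions met at a common index *)

Lemma directed_finite (K : Type) (I : finType) (P : K -> I -> Prop) (k0 : K) :
  (forall j k, exists l, forall i, P j i \/ P k i -> P l i) ->
  (forall i, exists k, P k i) -> exists k, forall i, P k i.
Proof.
move=> dirP exP.
have [k Pk] : exists k, forall i, i \in enum I -> P k i.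
  (* The index [k0] serves the empty list; directedness joins an index for the head with one for the
     tail. *)
  elim: (enum I) => [|i s [k Pk]]; first by exists k0.
  have [j Pj] := exP i; have [l Pl] := dirP j k.
  exists l => i'; rewrite inE => /predU1P[->|/Pk Pki']; apply: Pl; first by left.
  by right.
by exists k => i; apply: Pk; rewrite mem_enum.
Qed.

Lemma monotone_finite (I : finType) (P : nat -> I -> Prop) :
  (forall n k i, (n <= k)%N -> P n i -> P k i) ->
  (forall i, exists n, P n i) -> exists n, forall i, P n i.
Proof.
move=> monoP; apply: (@directed_finite nat I P 0%N) => j k; exists (maxn j k) => i.
by case; apply: monoP; rewrite ?leq_maxl ?leq_maxr.
Qed.

(** * Ideals, units and maximal ideals of a commutative ring *)

Section CommutativeRing.
Variable R : comNzRingType.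
Implicit Types (a b c x : R) (I J m : set R).

Lemma ideal_scale I a x : ideal I -> I x -> I (a * x).
Proof. by move=> [I0 /(_ a x 0) IE] Ix; rewrite -[_ * _]addr0; apply: IE. Qed.

Lemma ideal_sum I n (g : 'I_n -> R) (c : 'I_n -> R) : ideal I ->
  (forall i, I (g i)) -> I (\sum_(i < n) c i * g i).
Proof.
move=> idI Ig; apply: big_ind => [|x y Ix Iy|i _]; first by case: idI.
  by case: idI => _ /(_ 1 x y Ix Iy); rewrite mul1r.
exact: ideal_scale.
Qed.

Lemma principal_id a : principal a a.
Proof. by exists 1; rewrite mulr1. Qed.

Lemma principal_ideal a : ideal (principal a).
Proof.
split=> [|b _ _ [x ->] [y ->]]; first by exists 0; rewrite mulr0.
by exists (b * x + y); ring.
Qed.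

Lemma principal_sub I a : ideal I -> I a -> principal a `<=` I.
Proof. by move=> idI Ia _ [c ->]; rewrite mulrC; apply: ideal_scale. Qed.

Lemma fin_gen_principal a : fin_gen (principal a).
Proof.
exists 1%N, (fun=> a); apply/seteqP; split=> x /= [c ->].
  by exists (fun=> c); rewrite big_ord1 mulrC.
by exists (c ord0); rewrite big_ord1 mulrC.
Qed.

Lemma span_gen n (g : 'I_n -> R) (i : 'I_n) : Defs.span g (g i).
Proof.
exists (fun j => (i == j)%:R); rewrite (bigD1 i) //= eqxx mul1r.
by rewrite big1 ?addr0 // => j; rewrite eq_sym => /negbTE->; rewrite mul0r.
Qed.

(** Krull's theorem: Zorn's lemma applied to the proper ideals containing [I]. *)
Lemma proper_ideal_maximal I : ideal I -> ~ I 1 ->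
  exists2 m, maximal_ideal m & I `<=` m.
Proof.
move=> idI nI1.
(* [Zorn_bigcup] requires the union of the empty chain to satisfy [P]. *)
pose P J := J = set0 \/ [/\ ideal J, ~ J 1 & I `<=` J].
have PI : P I by rewrite /P; right; split.
have I0 : I 0 by case: idI.
have [|m [Pm maxm]] := @Zorn_bigcup R P.
  move=> F FP totF.
  (* If no member of the chain contains 0, all members are empty, and so is their union. *)
  have [[J0 FJ0 J00]|noF] := pselect (exists2 J, F J & J 0); last first.
    left; apply/seteqP; split=> // x [J FJ Jx].
    case: (FP J FJ) => [J_0|[[J0 _] _ _]]; first by rewrite J_0 in Jx.
    by case: noF; exists J.
  have FPn J x : F J -> J x -> [/\ ideal J, ~ J 1 & I `<=` J].
    by move=> FJ Jx; case: (FP J FJ) => // J_0; rewrite J_0 in Jx.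
  right; split; last first.
  - have [_ _ IJ0] := FPn _ _ FJ0 J00.
    by move=> x Ix; exists J0 => //; apply: IJ0.
  - by move=> [J FJ J1]; have [_ /(_ J1)] := FPn _ _ FJ J1.
  split; first by exists J0.
  move=> a x y [J FJ Jx] [K FK Ky].
  have [[_ JE] _ _] := FPn _ _ FJ Jx; have [[_ KE] _ _] := FPn _ _ FK Ky.
  have [JK|KJ] := totF _ _ FJ FK.
    by exists K => //; apply: KE => //; apply: JK.
  by exists J => //; apply: JE => //; apply: KJ.
(* The maximal element is not [set0], which [I] strictly contains. *)
have [idm nm1 Im] : [/\ ideal m, ~ m 1 & I `<=` m].
  case: Pm => // m0; case: (maxm I); last exact: PI.
  by rewrite m0; split=> // /(_ _ I0).
exists m => //; split=> // J idJ nJ1 mJ; apply: contrapT => neqJ.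
case: (maxm J); first by split=> // Jm; apply: neqJ; apply/seteqP.
by right; split=> //; apply: subset_trans mJ.
Qed.

(** Units are expressed by divisibility: [principal a 1] says that [a] divides 1. A non-unit lies in
    some maximal ideal, and [m] is the only one. *)
Lemma local_maximal_nonunit m : (forall m', maximal_ideal m' -> m = m') ->
  forall a, ~ principal a 1 -> m a.
Proof.
move=> m_uniq a /(proper_ideal_maximal (principal_ideal a))[m' /m_uniq -> am'].
exact/am'/principal_id.
Qed.

Lemma maximal_ideal_nonunit m a : maximal_ideal m -> m a -> ~ principal a 1.
Proof. by move=> [idm nm1 _] ma /(principal_sub idm ma). Qed.

(** Multiples of a non-unit are always non-units, so closure under sums is all that an ideal
    requires; any ideal not contained in it contains a unit. *)
Lemma maximal_ideal_nonunits :
  (forall a b, ~ principal a 1 -> ~ principal b 1 -> ~ principal (a + b) 1) ->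
  maximal_ideal [set a : R | ~ principal a 1].
Proof.
move=> nuD; split=> [|/=|J idJ nJ1 sJ].
- split=> /= [|a x y nx ny]; first by move=> [c /eqP]; rewrite mul0r oner_eq0.
  by apply: nuD => // -[c axc]; apply: nx; exists (a * c); rewrite axc; ring.
- by apply; apply: principal_id.
- apply/seteqP; split=> // x Jx /= x1; exact/nJ1/(principal_sub idJ Jx).
Qed.

Lemma local_nonunits :
  maximal_ideal [set a : R | ~ principal a 1] -> local_ring R.
Proof.
move=> maxm; exists [set a | ~ principal a 1]; split=> // m' maxm'.
have [_ _ max'] := maxm'; have [idm nm1 _] := maxm.
by apply: max' => // a /(maximal_ideal_nonunit maxm').
Qed.

End CommutativeRing.

(** * Divisibility and least common multiples in a subring *)

Section Subring.
Variables (R : comNzRingType) (S : subringClosed R).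

(** For [a] in [S], this is the principal ideal of the subring, seen as a subset of [R], so that
    different subrings can be compared. *)
Definition principal_in (a : R) : set R := [set x | exists2 c, c \in S & x = a * c].

Lemma principal_in_sub a : principal_in a `<=` principal a.
Proof. by move=> x [c _ ->]; exists c. Qed.

Lemma principal_in_id a : principal_in a a.
Proof. by exists 1; rewrite ?rpred1 ?mulr1. Qed.

Lemma subring_gcd (Sgcd : gcd_domain (subring S)) a b : a \in S -> b \in S ->
  exists2 c, c \in S & principal_in a `&` principal_in b = principal_in c.
Proof.
move=> aS bS; have [_ /(_ (Subring aS) (Subring bS))[c abc]] := Sgcd.
exists (\val c); first exact: subring_valP.
apply/seteqP; split=> x /=.
  move=> [[u uS xu] [v vS xv]].
  have : principal c (Subring aS * Subring uS).
    rewrite -abc; split; [by exists (Subring uS) | exists (Subring vS)].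
    by apply: val_inj; rewrite !rmorphM /= -xu -xv.
  move=> [w /(congr1 \val)]; rewrite !rmorphM /= -xu => ->.
  by exists (\val w) => //; apply: subring_valP.
move=> [w wS ->].
have : principal c (c * Subring wS) by exists (Subring wS).
rewrite -abc => -[[u /(congr1 \val) xu] [v /(congr1 \val) xv]].
by split; [exists (\val u); [exact: subring_valP | move: xu]
         | exists (\val v); [exact: subring_valP | move: xv]];
  rewrite !rmorphM.
Qed.

(** By induction on the list, the lcm of the head and of the lcm of the tail; the empty list has lcm
    1. *)
Lemma subring_lcm (Sgcd : gcd_domain (subring S)) (s : seq R) :
  {subset s <= S} ->
  exists2 l, l \in S & forall x, x \in S ->
    (forall a, a \in s -> principal_in a x) <-> principal_in l x.
Proof.
elim: s => [_|a s IHs sS].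
  exists 1 => [|x xS]; first exact: rpred1.
  by split=> // _; exists x; rewrite ?mul1r.
have [b bs|l lS lE] := IHs; first by apply: sS; rewrite inE bs orbT.
have [l' l'S al] := subring_gcd Sgcd (sS _ (mem_head a s)) lS.
exists l' => // x xS; rewrite -al; split=> [sx|[ax /(lE x xS) sx] b].
  split; first exact/sx/mem_head.
  by apply/(lE x xS) => b bs; apply: sx; rewrite inE bs orbT.
by rewrite inE => /predU1P[->|/sx].
Qed.

End Subring.

(** * Cancellation in domains and common divisors *)

Lemma domain_mulfI (R : comNzRingType) (a x y : R) : domain R ->
  a != 0 -> a * x = a * y -> x = y.
Proof.
move=> domR a0 /eqP; rewrite -subr_eq0 -mulrBr => /eqP /domR.
by rewrite (negPf a0) /= subr_eq0 => /eqP.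
Qed.

Lemma domain_prod_eq0 (R : comNzRingType) (I : finType) (a : I -> R) :
  domain R -> \prod_i a i = 0 -> exists i, a i = 0.
Proof.
move=> domR a0; apply: contrapT => na0; move/eqP: a0; apply/negP.
apply: (big_ind (fun x => x != 0)) => [|x y x0 y0|i _]; first exact: oner_neq0.
  by apply/eqP => /domR; rewrite (negPf x0) (negPf y0).
by apply/eqP => ai0; apply: na0; exists i.
Qed.

(** The intersection is [principal (a * b)], so the SBID property equates it with [principal a] or
    [principal b]; cancelling makes the other factor a unit. *)
Lemma sbid_pair (D : comNzRingType) (a b : D) : sbid D ->
  principal a `&` principal b `<=` principal (a * b) -> a != 0 -> b != 0 ->
  principal a 1 \/ principal b 1.
Proof.
move=> [domD sbD] capS a0 b0; pose f (i : 'I_2) := if i == ord0 then a else b.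
have fI : \bigcap_(i in [set: 'I_2]) principal (f i) = principal (a * b).
  apply/seteqP; split=> [x fx|_ [c ->] i _ /=].
    by apply: capS; split; [exact: (fx ord0) | exact: (fx ord_max)].
  rewrite /f; case: ifP => _; [exists (b * c) | exists (a * c)]; ring.
have [//||i] := sbD 2%N f; first by rewrite fI; apply: fin_gen_principal.
rewrite fI => abf; have : principal (a * b) (f i).
  by rewrite abf; apply: principal_id.
rewrite /f; case: ifP => _ [c abc]; [right | left]; exists c.
  by apply: (domain_mulfI domD a0); rewrite mulr1 {1}abc mulrA.
by apply: (domain_mulfI domD b0); rewrite mulr1 {1}abc; ring.
Qed.

Lemma directed_union_common_divisor (R : comNzRingType) (m : set R) (I : finType)
    (b : I -> R) : ideal m -> directed_union_of_principal m ->
  (forall i, m (b i)) -> exists2 c, m c & forall i, principal c (b i).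
Proof.
move=> [m0 _] [F [Fpr Fdir mF]] mb.
have mem a : m a <-> exists2 J, F J & J a by rewrite mF; split=> -[J]; exists J.
have Fm J c : F J -> J = principal c -> m c.
  by move=> FJ Jc; apply/mem; exists J => //; rewrite Jc; apply: principal_id.
have [J0 FJ0 _] := (mem 0).1 m0.
(* Indexing by the members of [F] turns its directedness into that of [P], so one member contains
   all [b i]; its generator is the divisor. *)
pose P (J : {J | F J}) i := sval J (b i).
have [||[J FJ] PJ] := @directed_finite _ _ P (exist _ J0 FJ0).
- move=> [J FJ] [K FK]; have [L FL [JL KL]] := Fdir _ _ FJ FK.
  by exists (exist _ L FL) => i [/JL|/KL].
- by move=> i; have [J FJ Jb] := (mem (b i)).1 (mb i); exists (exist _ J FJ).
have [c Jc] := Fpr _ FJ; exists c; first exact: Fm Jc.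
by move=> i; rewrite -Jc; apply: PJ.
Qed.

(** * Finite data descend to one stage of the union *)

Section Union.
Variables (D : comNzRingType) (Dn : nat -> subringClosed D).
Hypothesis Dn_gcd : forall n, gcd_domain (subring (Dn n)).
Hypothesis Dn_ascending : forall n, {subset Dn n <= Dn n.+1}.
Hypothesis D_union : forall x : D, exists n, x \in Dn n.

Lemma Dn_mono n k : (n <= k)%N -> {subset Dn n <= Dn k}.
Proof.
move/subnKC=> <-; elim: (k - n)%N => [|j IHj] x xn; first by rewrite addn0.
by rewrite addnS; apply/Dn_ascending/IHj.
Qed.

Lemma finite_family (I : finType) (f : I -> D) : exists n, forall i, f i \in Dn n.
Proof.
apply: (@monotone_finite _ (fun n i => f i \in Dn n)) => // n k i nk.
exact: Dn_mono.
Qed.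

Lemma D_domain : domain D.
Proof.
move=> x y xy0; have [n xyn] := finite_family (fun b : bool => if b then x else y).
have [domn _] := Dn_gcd n.
have := domn (Subring (xyn true)) (Subring (xyn false)).
rewrite -!(inj_eq val_inj) /= ?rmorph0; apply.
by apply: val_inj; rewrite rmorphM rmorph0.
Qed.

Lemma principal_in_union (I : finType) (a x : I -> D) :
  (forall i, principal (a i) (x i)) ->
  exists n, forall i, principal_in (Dn n) (a i) (x i).
Proof.
move=> ax.
apply: (@monotone_finite _ (fun n i => principal_in (Dn n) (a i) (x i))).
  by move=> n k i nk [c cn xc]; exists c => //; apply: Dn_mono cn.
by move=> i; have [c xc] := ax i; have [n cn] := D_union c; exists n, c.
Qed.

Lemma fin_gen_bigcap_principal (I : finType) (a : I -> D) :
  fin_gen (\bigcap_(i in [set: I]) principal (a i)) ->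
  exists l, \bigcap_(i in [set: I]) principal (a i) = principal l.
Proof.
move=> [k [g Ig]].
have gP j i : principal (a i) (g j).
  by have := span_gen g j; rewrite -Ig; apply.
have [n1 gn1] := finite_family g; have [n2 an2] := finite_family a.
have [n3 agn3] := principal_in_union (fun p : 'I_k * I => gP p.1 p.2).
(* Stage [N] contains the [g j], the [a i] and all quotients of [g j] by [a i], so the lcm of the
   [a i] in [Dn N] divides every [g j]. *)
pose N := maxn n1 (maxn n2 n3).
have gN j : g j \in Dn N by apply: Dn_mono (gn1 j); rewrite leq_maxl.
have aN i : a i \in Dn N.
  by apply: Dn_mono (an2 i); rewrite !leq_max leqnn orbT.
have agN j i : principal_in (Dn N) (a i) (g j).
  have [c cn gc] := agn3 (j, i); exists c => //.
  by apply: Dn_mono cn; rewrite !leq_max leqnn !orbT.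
have [_ /codomP[i ->]|l lN lE] := @subring_lcm _ _ (Dn_gcd N) (codom a).
  exact: aN.
exists l; apply/seteqP; split=> [x|_ [c ->] i _ /=].
  rewrite Ig => -[c ->]; apply: ideal_sum; first exact: principal_ideal.
  move=> j; apply/principal_in_sub/(lE _ (gN j)) => _ /codomP[i ->].
  exact: agN.
have /(_ (principal_in_id _ l) (a i)) := (lE l lN).2.
by rewrite codom_f => /(_ isT)[d _ ->]; exists (d * c); rewrite mulrA.
Qed.

(** * From a local ring to an SBID *)

Lemma directed_union_sbid : local_ring D ->
  (forall m, maximal_ideal m -> @directed_union_of_principal D m) -> sbid D.
Proof.
move=> [m [maxm m_uniq]] dirm; split; first exact: D_domain.
move=> s a s_gt0 fgI; have domD := D_domain; have [idm _ _] := maxm.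
have [l Il] := fin_gen_bigcap_principal fgI.
have memI x : (forall i, principal (a i) x) <-> principal l x.
  by rewrite -Il; split=> [ax i _ /=|ax i]; apply: ax.
(* If the intersection is zero, it contains the product of the [a i], so some [a i] is 0. *)
have [l0|l_neq0] := eqVneq l 0.
  have : principal l (\prod_i a i).
    by apply/memI => i; rewrite (bigD1 i) //=; eexists; reflexivity.
  rewrite l0 => -[c]; rewrite mul0r => /(domain_prod_eq0 domD)[i ai0].
  by exists i; rewrite Il l0 ai0.
have /choice[b lb] : forall i, exists c, l = a i * c.
  by move=> i; exact: (memI l).2 (principal_id l) i.
have [[i [u bu]]|nub] := pselect (exists i, principal (b i) 1).
  exists i; rewrite Il; apply/seteqP; split; apply: principal_sub.
  - exact: principal_ideal.
  - by exists (b i); apply: lb.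
  - exact: principal_ideal.
  - by exists u; rewrite {1}(lb i) -mulrA -bu mulr1.
have mb i : m (b i).
  by apply: (local_maximal_nonunit m_uniq) => bi; apply: nub; exists i.
have [c mc cb] := directed_union_common_divisor idm (dirm m maxm) mb.
case: (maximal_ideal_nonunit maxm mc).
have /choice[d bd] := cb.
(* The element [l'] is [l] divided by [c]; cancelling [c] shows that it equals [a i * d i] for every
   [i]. *)
pose i0 := Ordinal s_gt0; pose l' := a i0 * d i0.
have lc i : l = c * (a i * d i) by rewrite (lb i) bd; ring.
have c0 : c != 0 by apply: contra_neq l_neq0 => c0; rewrite (lc i0) c0 mul0r.
have [u l'u] : principal l l'.
  apply/memI => i; exists (d i); apply: (domain_mulfI domD c0).
  by rewrite -!lc.
have l'0 : l' != 0.
  by apply: contra_neq l_neq0 => l'0; rewrite (lc i0) -/l' l'0 mulr0.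
(* From [l' = l * u] and [l = c * l'], cancelling [l'] gives [1 = c * u]. *)
exists u; apply: (domain_mulfI domD l'0).
by rewrite mulr1 [LHS]l'u [in LHS](lc i0) -/l'; ring.
Qed.

(** * From an SBID to a local ring *)

Lemma sbid_common_divisor (a b : D) : sbid D ->
  ~ principal a 1 -> ~ principal b 1 ->
  exists c, [/\ ~ principal c 1, principal c a & principal c b].
Proof.
move=> sbD nua nub; have [domD _] := sbD.
have zero_div c : principal c 0 by exists 0; rewrite mulr0.
have [->|a0] := eqVneq a 0.
  by exists b; split=> //; apply: principal_id.
have [->|b0] := eqVneq b 0.
  by exists a; split=> //; apply: principal_id.
apply: contrapT => no_c.
suff : principal a `&` principal b `<=` principal (a * b).
  by case/(sbid_pair sbD)/(_ a0 b0).
move=> x [ax bx].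
have [n abx] : exists n, forall i : bool,
    principal_in (Dn n) (if i then a else b) x.
  by apply: (@principal_in_union _ _ (fun=> x)) => -[].
have [n' abn'] := finite_family (fun i : bool => if i then a else b).
pose N := maxn n n'.
have abN i : (if i then a else b) \in Dn N.
  by apply: Dn_mono (abn' i); rewrite leq_maxr.
have abxN (i : bool) : principal_in (Dn N) (if i then a else b) x.
  have [c cn xc] := abx i; exists c => //.
  by apply: Dn_mono cn; rewrite leq_maxl.
have aN := abN true; have bN := abN false.
have [l lN lE] := subring_gcd (Dn_gcd N) aN bN.
(* With [l] the lcm in [Dn N], the cofactor [g] in [a * b = l * g] divides both [a] and [b], hence
   is a unit of [D]. *)
have [g _ abg] : principal_in (Dn N) l (a * b).
  by rewrite -lE; split; [exists b | exists a => //; rewrite mulrC].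
have : (principal_in (Dn N) a `&` principal_in (Dn N) b) l.
  by rewrite lE; apply: principal_in_id.
move=> [[u _ lu] [v _ lv]].
have ga : principal g a.
  exists v; apply: (domain_mulfI domD b0).
  by rewrite mulrC abg lv; ring.
have gb : principal g b.
  exists u; apply: (domain_mulfI domD a0).
  by rewrite abg lu; ring.
have [w gw] : principal g 1.
  by apply: contrapT => nug; apply: no_c; exists g.
have : principal_in (Dn N) l x.
  by rewrite -lE; split; [exact: (abxN true) | exact: (abxN false)].
(* Since [g * w = 1], [l] equals [a * b * w]. *)
move=> [y _ ->]; exists (w * y).
by rewrite abg -[l in LHS]mulr1 gw; ring.
Qed.

(** A common non-unit divisor of two non-units also divides their sum. *)
Lemma sbid_maximal_ideal : sbid D ->
  maximal_ideal [set a : D | ~ principal a 1].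
Proof.
move=> sbD; apply: maximal_ideal_nonunits => a b nua nub [u abu].
have [c [nuc [a' ac] [b' bc]]] := sbid_common_divisor sbD nua nub.
by apply: nuc; exists ((a' + b') * u); rewrite abu ac bc; ring.
Qed.

(** The family consists of the principal ideals of all non-units; common non-unit divisors make it
    directed. *)
Lemma sbid_directed_union : sbid D ->
  directed_union_of_principal [set a : D | ~ principal a 1].
Proof.
move=> sbD; exists [set J | exists2 c, ~ principal c 1 & J = principal c].
split=> [J [c _ ->]|_ _ [a nua ->] [b nub ->]|]; first by exists c.
  have [c [nuc ca cb]] := sbid_common_divisor sbD nua nub.
  exists (principal c); first by exists c.
  by split; apply: principal_sub => //; apply: principal_ideal.
have maxm := sbid_maximal_ideal sbD; have [idm _ _] := maxm.
apply/seteqP; split=> [a nua|a [_ [c nuc ->]]].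
  by exists (principal a); [exists a | apply: principal_id].
exact: (principal_sub idm nuc).
Qed.

End Union.

Theorem theorem2p11 (D : comNzRingType) (Dn : nat -> subringClosed D)
    (Dn_noetherian : forall n, noetherian (subring (Dn n)))
    (Dn_gcd : forall n, gcd_domain (subring (Dn n)))
    (Dn_ascending : forall n, {subset Dn n <= Dn n.+1})
    (D_union : forall x : D, exists n, x \in Dn n) :
  sbid D <->
  (local_ring D /\
   forall m, maximal_ideal m -> @directed_union_of_principal D m).
Proof.
split=> [sbD|[locD dirm]]; last exact: (directed_union_sbid (Dn := Dn)).
have maxm := sbid_maximal_ideal Dn_gcd Dn_ascending D_union sbD.
have locD := local_nonunits maxm; split=> // m maxm'.
(* By uniqueness, [m] is the set of non-units. *)
have [m0 [_ m0_uniq]] := locD; rewrite -(m0_uniq _ maxm') (m0_uniq _ maxm).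
exact: (sbid_directed_union (Dn := Dn)).
Qed.
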